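(* Let $\pi_1,\pi_2,\pi_3$ be Borel probability measures on $\mathbb{R}_+=[0,\infty)$ and let $\mu=\pi_1\times\pi_2\times\pi_3$ on $\mathbb{R}_+^3$. Let $R:\mathbb{R}_+^3\to\mathbb{R}_+^3$ be $$R(r,s,t)=\bigl(t+[r-s]^+,\;t+[s-r]^+,\;r\wedge s\bigr),$$ and suppose that $R\mu=\mu$, where $R\mu$ is the push-forward of $\mu$ under $R$. Let $\tilde U_i=\mathrm{supp}(\pi_i)$, $t_0=\min\tilde U_3$, $U_i=\tilde U_i-t_0$ and $F_i(t)=\pi_i\bigl([t_0+t,\infty)\bigr)$ for $i=1,2,3$. Then exactly one of the following holds: (1) $U_3=\{0\}$; (2) $U_1=U_2=U_3=\mathbb{R}_+$, and there are $\alpha_1,\alpha_2\in(0,\infty)$ such that $F_i(t)=e^{-\alpha_i t}$ for $t\ge 0$ and $i=1,2,3$, where $\alpha_3=\alpha_1+\alpha_2$; (3) there is $c>0$ such that $U_1=U_2=U_3=c\mathbb{Z}_+$, and there are $\lambda_1,\lambda_2\in(0,1)$ such that $F_i(cn)=\lambda_i^n$ for $n\in\mathbb{Z}_+$ and $i=1,2,3$, where $\lambda_3=\lambda_1\lambda_2$.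
   Context: $\mathrm{supp}(\pi)$ denotes the support of $\pi$, i.e. the intersection of all closed sets of full $\pi$-measure. $\mathbb{Z}_+=\{0,1,2,\dots\}$ and $[a]^+=\max(a,0)$. Interpretation (not needed for the statement): $r$ and $s$ are the masses of ascending and descending particles entering a site, $t$ is the mass born there, and $R\mu=\mu$ is the self-duality (time-reversibility) condition for the broken line process. *)

(* Defs.v *)
From HB Require Import structures.
From mathcomp Require Import all_boot all_order all_algebra.
From mathcomp Require Import all_classical all_reals all_analysis.
Set Implicit Arguments. Unset Strict Implicit. Unset Printing Implicit Defensive.
Import Order.TTheory GRing.Theory Num.Theory.
Import numFieldNormedType.Exports.
Local Open Scope classical_set_scope.
Local Open Scope ring_scope.

Definition supp (R : realType) (P : probability R R) : set R :=
  [set x | forall C : set R, closed C -> P C = 1%E -> C x].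

Definition Rmap (R : realType) (x : (R * R) * R) : (R * R) * R :=
  let r := x.1.1 in let s := x.1.2 in let t := x.2 in
  ((t + Num.max (r - s) 0, t + Num.max (s - r) 0), Num.min r s).

Definition exactly_one3 (A B C : Prop) : Prop :=
  [\/ [/\ A, ~ B & ~ C], [/\ ~ A, B & ~ C] | [/\ ~ A, ~ B & C]].

(* Main.v *)
Require Import Defs.
From HB Require Import structures.
From mathcomp Require Import all_boot all_order all_algebra.
From mathcomp Require Import all_classical all_reals all_analysis.
From mathcomp Require Import measurable_realfun ring lra.
Set Implicit Arguments. Unset Strict Implicit. Unset Printing Implicit Defensive.
Import Order.TTheory GRing.Theory Num.Theory.
Import numFieldNormedType.Exports.
Local Open Scope classical_set_scope.
Local Open Scope ring_scope.

(** Invariance says that Z = min(r, s) has law pi3 and is independent of r - s,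
    so F3 = F1 F2 and, for b >= 0, the measure F1(s + b) pi2(ds) is C(b) pi3(ds),
    where C(b) = P(r >= s + b); symmetrically with pi1 and pi2 exchanged.
    When C(0) > 0 this forces F1(s + b) / F1(s) not to depend on s, for pi3-almost
    every s: a lack of memory on a pi3-full set S.  Unless pi3 is a point mass,
    C(0) = 0 is impossible: it would make F2 = 1 pi3-almost everywhere, against
    the strict decrease of F2 between points of S.
    If S has arbitrarily close points, then - ln F1 and - ln F2 are linear beyond
    t0 and the laws are exponential.  Otherwise S is discrete, t0 is in S and, c
    being the distance from t0 to the next point, F1 F2 = F3 is constant on
    (t0, t0 + c], hence so are F1 and F2, and the laws are geometric. *)

(** * Additive and multiplicative functions on a half-line *)

Lemma arbitrarily_small_le0 (R : realType) (x K : R) :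
  0 <= K -> (forall e, 0 < e -> x <= K * e) -> x <= 0.
Proof.
move=> K0 H; apply/ler_addgt0Pr => e e0; rewrite add0r.
have K1 : 0 < K + 1 by lra.
apply: le_trans (H (e / (K + 1)) _) _; first by rewrite divr_gt0.
rewrite mulrCA ler_piMr// ?(ltW e0)// ler_pdivrMr//; lra.
Qed.

Lemma linear_bound_eq0 (R : realType) (x K : R) :
  (forall b, 0 <= b -> `|x| * b <= K) -> x = 0.
Proof.
move=> H; apply: contrapT => /eqP x0.
have xp : 0 < `|x| by rewrite normr_gt0.
have := H ((`|K| + 1) / `|x|).
rewrite mulrCA divff ?gt_eqF// mulr1 => /(_ _) Hk.
have /Hk : 0 <= (`|K| + 1) / `|x| by rewrite divr_ge0// ?addr_ge0.
have := ler_norm K; lra.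
Qed.

Section partial_additivity.
Variables (R : realType) (L : R -> R).
Hypothesis Lnd : forall x y, 0 <= x -> x <= y -> L x <= L y.
Hypothesis L0 : L 0 = 0.

(** Additivity is asked only in the direction [h]: the steps available later are the gaps between
    points of [S]. *)
Definition additive_step (h : R) := 0 < h /\ forall b, 0 <= b -> L (h + b) = L h + L b.

Lemma additive_stepMn h (n : nat) b : additive_step h -> 0 <= b ->
  L (h * n%:R + b) = L h * n%:R + L b.
Proof.
move=> [h0 Lh] b0; elim: n => [|n IH]; first by rewrite !mulr0 !add0r.
have -> : h * n.+1%:R + b = h + (h * n%:R + b) by rewrite -natr1; ring.
rewrite Lh ?IH -?natr1; first ring.
by rewrite addr_ge0// mulr_ge0// ltW.
Qed.

(** If [b] lies between [h * n] and [h * (n + 1)], then [L b] and the line of slope [L h / h] both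
    lie between [L h * n] and [L h * (n + 1)]. *)
Lemma additive_step_bound h b : additive_step h -> 0 <= b ->
  `|L b - L h / h * b| <= L h.
Proof.
move=> Sh b0; have h0 := Sh.1.
have Lh0 : 0 <= L h by rewrite -L0 Lnd// ltW.
have bh0 : 0 <= b / h by rewrite divr_ge0// ltW.
have /andP[] := truncn_itv bh0; set n := Num.truncn _.
rewrite ler_pdivlMr// ltr_pdivrMr// -natr1 => nb bn.
have H0 : L h * n%:R <= L b.
  rewrite -[leLHS]addr0 -L0 -additive_stepMn// addr0 Lnd// 1?mulrC//.
  by rewrite mulr_ge0// ltW.
have H1 : L b <= L h * n.+1%:R.
  rewrite -[leRHS]addr0 -L0 -additive_stepMn// addr0 Lnd//.
  by rewrite mulrC -natr1 ltW.
have H2 : L h / h * b <= L h * n.+1%:R.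
  rewrite -mulrA ler_wpM2l// mulrC ler_pdivrMr// -natr1; lra.
have H3 : L h * n%:R <= L h / h * b.
  rewrite -mulrA ler_wpM2l// mulrC ler_pdivlMr//.
by rewrite -natr1 in H1 H2; rewrite ler_norml; apply/andP; split; lra.
Qed.

(** Lines at bounded distance from the same [L] have equal slopes, so all steps share one slope; the
    error bound [L k] of a step [k] is then proportional to [k] and can be made arbitrarily
    small. *)
Lemma small_steps_linear : (forall e, 0 < e -> exists h, additive_step h /\ h < e) ->
  exists a, 0 <= a /\ forall b, 0 <= b -> L b = a * b.
Proof.
move=> Hsmall; have [h [Sh _]] := Hsmall 1 ltr01.
have h0 := Sh.1.
have L_ge0 x : 0 <= x -> 0 <= L x by move=> x0; rewrite -L0 Lnd.
have a0 : 0 <= L h / h by rewrite divr_ge0 ?L_ge0 ?(ltW h0).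
exists (L h / h); split => // b b0.
have slope k : additive_step k -> L k / k = L h / h.
  move=> Sk; apply/eqP; rewrite -subr_eq0; apply/eqP.
  apply: (@linear_bound_eq0 _ _ (L h + L k)) => c c0.
  rewrite -[X in _ * X](ger0_norm c0) -normrM mulrBl.
  have -> : L k / k * c - L h / h * c = (L c - L h / h * c) - (L c - L k / k * c) by lra.
  by rewrite (le_trans (ler_normB _ _))// lerD// additive_step_bound.
apply/eqP; rewrite -subr_eq0 -normr_le0.
apply: (arbitrarily_small_le0 a0) => e e0.
have [k [Sk ke]] := Hsmall e e0.
have := @additive_step_bound k b Sk b0; rewrite (slope _ Sk) => /le_trans; apply.
have k0 := Sk.1.
by rewrite -(slope _ Sk) -mulrA ler_peMr ?L_ge0 ?(ltW k0)// mulrC ler_pdivlMr// mul1r ltW.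
Qed.
End partial_additivity.

Lemma archi_step (R : realType) (h x : R) : 0 < h -> exists n : nat, x <= h * n%:R.
Proof.
move=> h0; exists (Num.truncn (`|x| / h)).+1.
have x0 : 0 <= `|x| / h by rewrite divr_ge0// ltW.
have /andP[_] := truncn_itv x0.
rewrite ltr_pdivrMr// mulrC => /ltW; apply: le_trans; exact: ler_norm.
Qed.

(** * Functions with proportional shifts: lack of memory along a set *)

Section proportional_tails.
Variables (R : realType) (f : R -> R) (S : set R).

Hypothesis f_ni : forall x y, x <= y -> f y <= f x.
Hypothesis f_small : forall e, 0 < e -> exists x, f x < e.
Hypothesis S_pos : forall s, S s -> 0 < f s.
Hypothesis S_prop : forall s s' b, S s -> S s' -> 0 <= b ->
  f (s + b) * f s' = f (s' + b) * f s.

(** Move the base point from [s] to [s0]: the total shift then ends at [s1 + b], and the base point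
    can be moved from [s1] back to [s]. *)
Lemma shift_ratio s0 s1 s b : S s0 -> S s1 -> S s -> s0 < s1 -> 0 <= b ->
  f (s + (s1 - s0) + b) = f s1 / f s0 * f (s + b).
Proof.
move=> S0 S1 Ss s01 b0.
have e1 : f (s + ((s1 - s0) + b)) * f s0 = f (s0 + ((s1 - s0) + b)) * f s.
  by apply: S_prop => //; lra.
have e2 : f (s1 + b) * f s = f (s + b) * f s1 by exact: S_prop.
have f0 : f s0 != 0 by rewrite gt_eqF ?S_pos.
apply: (mulIf f0); rewrite -addrA e1.
have -> : s0 + (s1 - s0 + b) = s1 + b by lra.
by rewrite e2; field.
Qed.

Lemma shift_ratioXn s0 s1 s b (n : nat) : S s0 -> S s1 -> S s -> s0 < s1 -> 0 <= b ->
  f (s + (s1 - s0) * n%:R + b) = (f s1 / f s0) ^+ n * f (s + b).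
Proof.
move=> S0 S1 Ss s01 b0; elim: n => [|n IH]; first by rewrite mulr0 addr0 mul1r.
(* All but one step go into the shift, so the base point stays [s]: the intermediate points need not
   be in [S]. *)
have -> : s + (s1 - s0) * n.+1%:R + b = s + (s1 - s0) + ((s1 - s0) * n%:R + b).
  by rewrite -natr1; ring.
rewrite shift_ratio//; last by rewrite addr_ge0// mulr_ge0//; lra.
by rewrite addrA IH exprS mulrA.
Qed.

(** With ratio 1, [f] would take the value [f s0] at arbitrarily distant points, against
    [f_small]. *)
Lemma ratio_lt1 s0 s1 : S s0 -> S s1 -> s0 < s1 -> f s1 < f s0.
Proof.
move=> S0 S1 s01; rewrite lt_neqAle f_ni ?(ltW s01)// andbT.
apply/eqP => e; have f0 := S_pos S0.
have [x fx] := f_small f0.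
have [|n xn] := @archi_step _ (s1 - s0) (x - s0); first lra.
have := @shift_ratioXn s0 s1 s0 0 n S0 S1 S0 s01 (lexx 0).
rewrite !addr0 e divff ?gt_eqF// expr1n mul1r => e'.
have /f_ni : x <= s0 + (s1 - s0) * n%:R by lra.
lra.
Qed.

Lemma proportional_tail_gt0 s0 s1 x : S s0 -> S s1 -> s0 < s1 -> 0 < f x.
Proof.
move=> S0 S1 s01; have f0 := S_pos S0.
have [|n xn] := @archi_step _ (s1 - s0) (x - s0); first lra.
have := @shift_ratioXn s0 s1 s0 0 n S0 S1 S0 s01 (lexx 0).
rewrite !addr0 => e'.
have /f_ni : x <= s0 + (s1 - s0) * n%:R by lra.
by apply: lt_le_trans; rewrite e' mulr_gt0// exprn_gt0// divr_gt0// S_pos.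
Qed.

(** The gaps of [S] are additive steps of [ln (f s0) - ln (f (s0 + b))], which is therefore linear
    in [b]; its slope is positive by [ratio_lt1], and [S_prop] carries the formula from [s0] to the
    other points. *)
Lemma dense_gaps_expR :
  (forall e, 0 < e -> exists s0 s1, [/\ S s0, S s1, s0 < s1 & s1 - s0 < e]) ->
  exists a, 0 < a /\ forall s b, S s -> 0 <= b -> f (s + b) = expR (- (a * b)) * f s.
Proof.
move=> Hd; have [s0 [s1 [S0 S1 s01 _]]] := Hd 1 ltr01.
have fp x : 0 < f x by exact: proportional_tail_gt0 S0 S1 s01.
pose L b := ln (f s0) - ln (f (s0 + b)).
have [||e|a [a0 La]] := @small_steps_linear _ L.
- move=> x y _ xy; rewrite /L lerD2l lerN2 ler_ln ?posrE// f_ni//; lra.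
- by rewrite /L addr0 subrr.
- move=> e0; have [u [v [Su Sv uv uve]]] := Hd e e0; exists (v - u); split => //.
  split; first lra.
  move=> b b0; have := shift_ratio Su Sv S0 uv b0.
  have := shift_ratio Su Sv S0 uv (lexx 0); rewrite !addr0 => e1 e2.
  rewrite /L addrA e1 e2 !lnM ?posrE ?divr_gt0 ?invr_gt0//; lra.
have fs0 b : 0 <= b -> f (s0 + b) = expR (- (a * b)) * f s0.
  move=> b0; have := La b b0; rewrite /L => e.
  apply: ln_inj; rewrite ?posrE// ?mulr_gt0 ?expR_gt0//.
  rewrite lnM ?posrE ?expR_gt0// expRK; lra.
exists a; split.
  rewrite lt_neqAle a0 andbT eq_sym; apply/eqP => az.
  have := ratio_lt1 S0 S1 s01.
  have := @fs0 (s1 - s0); rewrite az mul0r oppr0 expR0 mul1r (addrC s0) subrK => -> //; lra.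
move=> s b Ss b0; have f0 : f s0 != 0 by rewrite gt_eqF.
by apply: (mulIf f0); rewrite (S_prop Ss S0 b0) fs0//; ring.
Qed.

Variable t0 : R.
Hypothesis S_ge : forall s, S s -> t0 <= s.
Hypothesis ft0 : f t0 = 1.
Hypothesis S_near : forall e, 0 < e -> exists s, [/\ S s, s < t0 + e & 1 - e < f s].

(** Since [t0] need not be in [S], the formula is used from points [s] of [S] tending to [t0] with
    [f s] tending to 1. *)
Lemma dense_gaps_tail_expR :
  (forall e, 0 < e -> exists s0 s1, [/\ S s0, S s1, s0 < s1 & s1 - s0 < e]) ->
  exists a, 0 < a /\ forall t, 0 <= t -> f (t0 + t) = expR (- (a * t)).
Proof.
move=> /dense_gaps_expR [a [a0 fa]]; exists a; split => // t.
rewrite le_eqVlt => /predU1P[<-|tp]; first by rewrite addr0 mulr0 oppr0 expR0.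
set y := f (t0 + t) * expR (a * t).
have Hs e : 0 < e -> exists s, [/\ S s, t0 <= s, s < t0 + e, 1 - e < f s &
    y = expR (a * (s - t0)) * f s].
  (* The minimum with [t] keeps [s] below [t0 + t], so the shift from [s] to [t0 + t] is
     nonnegative. *)
  move=> e0; have [|s [Ss ste fs]] := @S_near (Num.min e t); first by rewrite lt_min e0.
  have se : s < t0 + e by apply: lt_le_trans ste _; rewrite lerD2l ge_min lexx.
  have st : s < t0 + t by apply: lt_le_trans ste _; rewrite lerD2l ge_min lexx orbT.
  exists s; split => //; first exact: S_ge.
    by apply: le_lt_trans fs; rewrite lerD2l lerN2 ge_min lexx.
  have -> : y = f (s + (t0 + t - s)) * expR (a * t) by rewrite /y; congr (f _ * _); lra.
  rewrite fa//; last lra.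
  by rewrite mulrAC -expRD; congr (expR _ * _); ring.
have [s [Ss _ _ _ ys]] := Hs 1 ltr01.
have y0 : 0 < y by rewrite ys mulr_gt0 ?expR_gt0 ?S_pos.
have y1 : y = 1.
  apply/eqP; rewrite eq_le; apply/andP; split.
    rewrite -ler_ln ?posrE// ln1.
    apply: (arbitrarily_small_le0 (ltW a0)) => e e0.
    have [u [Su t0u ute fu yu]] := Hs e e0.
    have fu1 : f u <= 1 by rewrite -ft0 f_ni.
    rewrite yu lnM ?posrE ?expR_gt0 ?S_pos// expRK.
    have : ln (f u) <= 0 by rewrite ln_le0.
    have : a * (u - t0) <= a * e by rewrite ler_pM2l//; lra.
    lra.
  rewrite -subr_le0; apply: (@arbitrarily_small_le0 _ _ 1) => // e e0.
  have [u [Su t0u ute fu yu]] := Hs e e0.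
  have : f u <= y.
    rewrite yu ler_peMl// ?(ltW (S_pos Su))// -expR0 ler_expR mulr_ge0//; [exact: ltW|lra].
  lra.
by rewrite expRN -[LHS]mulr1 -[X in _ * X](divff (lt0r_neq0 (expR_gt0 (a * t)))) mulrA -/y y1 mul1r.
Qed.

(** Shifting by [c] multiplies [f] by [f (t0 + c)], because [f t0 = 1]. The constant pieces are open
    on the left and closed on the right, whence the exponent [n.+1] inside a cell. *)
Lemma separated_tail_geometric c : 0 < c -> S t0 -> S (t0 + c) ->
  (forall x, 0 < x -> x <= c -> f (t0 + x) = f (t0 + c)) ->
  exists l, [/\ 0 < l < 1, (forall n : nat, f (t0 + c * n%:R) = l ^+ n) &
    forall (n : nat) x, 0 < x -> x <= c -> f (t0 + c * n%:R + x) = l ^+ n.+1].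
Proof.
move=> c0 S0 Sc Hc; exists (f (t0 + c)).
have s01 : t0 < t0 + c by lra.
have H n b : 0 <= b -> f (t0 + c * n%:R + b) = f (t0 + c) ^+ n * f (t0 + b).
  move=> b0; have := @shift_ratioXn t0 (t0 + c) t0 b n S0 Sc S0 s01 b0.
  by rewrite ft0 divr1 (_ : t0 + c - t0 = c) //; lra.
split.
- by apply/andP; split; [exact: S_pos|rewrite -ft0; exact: ratio_lt1].
- by move=> n; have := H n 0 (lexx 0); rewrite !addr0 ft0 mulr1.
- by move=> n x x0 xc; rewrite H ?(ltW x0)// Hc// exprSr.
Qed.
End proportional_tails.

Lemma separated_min_gap (R : realType) (S : set R) (t0 eta s1 : R) : 0 < eta ->
  (forall s, S s -> t0 <= s) ->
  (forall e, 0 < e -> exists s, S s /\ s < t0 + e) ->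
  (forall s s', S s -> S s' -> s < s' -> eta <= s' - s) -> S s1 -> t0 < s1 ->
  exists c, [/\ 0 < c, S t0, S (t0 + c) & forall s, S s -> t0 < s -> t0 + c <= s].
Proof.
move=> eta0 S_ge S_near sep S1 ts1.
(* A separated set contains any lower bound that it approaches: otherwise two of its points would
   lie within [eta] above [m]. This is applied to [S] at [t0] and to the points of [S] beyond
   [t0]. *)
have sep_eq (T : set R) m : T `<=` S -> (forall s, T s -> m <= s) ->
    (forall e, 0 < e -> exists s, T s /\ s < m + e) -> T m.
  move=> TS Tm Tn; have [s [Ts se]] := Tn eta eta0.
  have := Tm s Ts; rewrite le_eqVlt => /predU1P[->//|ms].
  have [|s' [Ts' s'e]] := Tn (s - m); first lra.
  have := Tm s' Ts' => ms'.
  have := sep s' s (TS _ Ts') (TS _ Ts); lra.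
have S0 : S t0 by apply: sep_eq => //.
pose T := [set s | S s /\ t0 < s].
have Tinf : has_inf T.
  by split; [exists s1|exists t0 => s [_ /ltW]].
have Tm s : T s -> inf T <= s by move=> Ts; apply: ge_inf => //; case: Tinf.
have [Si ti] : T (inf T).
  apply: sep_eq => //; first by move=> s [].
  by move=> e e0; have [s Ts se] := inf_adherent e0 Tinf; exists s.
exists (inf T - t0); split => //; first lra.
- by rewrite addrC subrK.
- by move=> s Ss ts; rewrite addrC subrK; apply: Tm.
Qed.

(** A drop of one positive factor could not be compensated by the other, which does not increase
    either. *)
Lemma mulr_eq_ni_eq (R : realType) (f g : R -> R) x y : x <= y ->
  (forall x y, x <= y -> f y <= f x) -> (forall x y, x <= y -> g y <= g x) ->
  0 < f y -> 0 < g y -> f x * g x = f y * g y -> f x = f y.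
Proof.
move=> xy /(_ _ _ xy) fx /(_ _ _ xy) gx fy gy e.
apply/eqP; rewrite eq_le fx andbT.
rewrite -(ler_pM2r gy) -e ler_pM2l//; lra.
Qed.

(** The case split concerns the gaps of [S] alone, so [f] and [g] fall into the same case with the
    same [c]. The last hypothesis is what makes [f * g] behave as the tail of a law carried by
    [S]. *)
Theorem tail_dichotomy (R : realType) (f g : R -> R) (S : set R) (t0 : R) :
  (forall x y, x <= y -> f y <= f x) -> (forall x y, x <= y -> g y <= g x) ->
  (forall e, 0 < e -> exists x, f x < e) -> (forall e, 0 < e -> exists x, g x < e) ->
  (forall s, S s -> 0 < f s) -> (forall s, S s -> 0 < g s) ->
  (forall s s' b, S s -> S s' -> 0 <= b -> f (s + b) * f s' = f (s' + b) * f s) ->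
  (forall s s' b, S s -> S s' -> 0 <= b -> g (s + b) * g s' = g (s' + b) * g s) ->
  (forall s, S s -> t0 <= s) -> f t0 = 1 -> g t0 = 1 ->
  (forall e, 0 < e -> exists s, [/\ S s, s < t0 + e & 1 - e < f s * g s]) ->
  (exists s, S s /\ t0 < s) ->
  (forall x y, x <= y -> (forall s, S s -> x <= s -> s < y -> False) ->
    f x * g x = f y * g y) ->
  (exists a b, [/\ 0 < a, 0 < b & forall t, 0 <= t ->
     f (t0 + t) = expR (- (a * t)) /\ g (t0 + t) = expR (- (b * t))]) \/
  (exists c l m, [/\ 0 < c, 0 < l < 1, 0 < m < 1,
     (forall n : nat, f (t0 + c * n%:R) = l ^+ n /\ g (t0 + c * n%:R) = m ^+ n) &
     forall (n : nat) x, 0 < x -> x <= c ->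
       f (t0 + c * n%:R + x) = l ^+ n.+1 /\ g (t0 + c * n%:R + x) = m ^+ n.+1]).
Proof.
move=> fni gni fs gs fp gp fpr gpr Sge f0 g0 near [s1 [S1 ts1]] full.
(* On [S] the other factor is at most 1, so a product close to 1 has both factors close to 1. *)
have nearf e : 0 < e -> exists s, [/\ S s, s < t0 + e & 1 - e < f s].
  move=> /near[s [Ss se fge]]; exists s; split => //.
  apply: lt_le_trans fge _; rewrite ler_piMr ?(ltW (fp _ Ss))// -g0 gni//; exact: Sge.
have nearg e : 0 < e -> exists s, [/\ S s, s < t0 + e & 1 - e < g s].
  move=> /near[s [Ss se fge]]; exists s; split => //.
  apply: lt_le_trans fge _; rewrite ler_piMl ?(ltW (gp _ Ss))// -f0 fni//; exact: Sge.
have [H|] := pselect (forall e, 0 < e ->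
    exists u v, [/\ S u, S v, u < v & v - u < e]).
  left; have [a [a0 fa]] := dense_gaps_tail_expR fni fs fp fpr Sge f0 nearf H.
  have [b [b0 gb]] := dense_gaps_tail_expR gni gs gp gpr Sge g0 nearg H.
  by exists a, b; split => // t t0'; rewrite fa ?gb.
move=> /existsNP[eta /not_implyP[eta0 sep]]; right.
have [||c [c0 S0 Sc gap]] := separated_min_gap eta0 Sge _ _ S1 ts1.
- by move=> e /near[s [Ss se _]]; exists s.
- move=> s s' Ss Ss' ss'; rewrite leNgt; apply/negP => h; apply: sep.
  by exists s, s'.
have const x : 0 < x -> x <= c -> f (t0 + x) * g (t0 + x) = f (t0 + c) * g (t0 + c).
  move=> x0 xc; apply: full; first lra.
  move=> s Ss sx sc; have : t0 + c <= s by apply: gap => //; lra.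
  lra.
have [|l [l01 fl fl']] := separated_tail_geometric fni fs fp fpr f0 c0 S0 Sc.
  move=> x x0 xc; apply: (mulr_eq_ni_eq (g := g)) => //; [lra|exact: fp|exact: gp|exact: const].
have [|m [m01 gm gm']] := separated_tail_geometric gni gs gp gpr g0 c0 S0 Sc.
  move=> x x0 xc; apply: (mulr_eq_ni_eq (g := f)) => //; [lra|exact: gp|exact: fp|].
  by rewrite mulrC const// mulrC.
exists c, l, m; split => // n x x0 xc.
by rewrite fl' ?gm'.
Qed.

(** * Tails and supports of probability measures *)

Definition tail (R : realType) (p : probability R R) (x : R) : R :=
  fine (p `[x, +oo[%classic).

Section tail_theory.
Variables (R : realType) (p : probability R R).
Implicit Types (x y e : R) (A B : set R).

Lemma fine_probability_le A B : measurable A -> measurable B -> A `<=` B ->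
  fine (p A) <= fine (p B).
Proof. by move=> mA mB AB; rewrite fine_le ?fin_num_measure// le_measure ?inE. Qed.

Lemma tailE x : p `[x, +oo[%classic = (tail p x)%:E.
Proof. by rewrite /tail fineK// fin_num_measure. Qed.

Lemma tail_ge0 x : 0 <= tail p x.
Proof. by rewrite /tail fine_ge0. Qed.

Lemma tail_le1 x : tail p x <= 1.
Proof. by rewrite -lee_fin -tailE probability_le1. Qed.

Lemma tail_ni x y : x <= y -> tail p y <= tail p x.
Proof.
by move=> xy; apply: fine_probability_le => // z /=; rewrite !in_itv/= !andbT; apply: le_trans.
Qed.

Lemma probability_bigcap_lt (F : (set R)^nat) e : (forall i, measurable (F i)) ->
  {homo F : n m / (n <= m)%N >-> m `<=` n} -> 0 < e ->
  exists n, fine (p (F n)) < fine (p (\bigcap_n F n)) + e.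
Proof.
move=> mF Fni e0.
have mc : measurable (\bigcap_n F n) by exact: bigcapT_measurable.
have : p (F n) @[n --> \oo] --> (fine (p (\bigcap_n F n)))%:E.
  rewrite fineK ?fin_num_measure//; apply: nonincreasing_cvg_mu => //.
    by rewrite ltey_eq fin_num_measure.
  by move=> n m nm; apply/subsetPset/Fni.
move=> /fine_cvg /cvgr_lt /(_ (fine (p (\bigcap_n F n)) + e)).
rewrite ltrDl => /(_ e0) [N _ H]; exists N; exact: (H N (leqnn N)).
Qed.

Lemma tail_small e : 0 < e -> exists x, tail p x < e.
Proof.
move=> e0; have [||n] := @probability_bigcap_lt (fun n => `[n%:R, +oo[%classic) e _ _ e0.
- by move=> i; exact: measurable_itv.
- move=> n m nm z /=; rewrite !in_itv/= !andbT; apply: le_trans; by rewrite ler_nat.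
- rewrite (_ : \bigcap_n _ = set0) ?measure0 ?add0r; first by exists n%:R.
  rewrite -subset0 => z /= /(_ (Num.truncn `|z|).+1 I).
  rewrite /= in_itv/= andbT => h.
  have /andP[_] := truncn_itv (normr_ge0 z).
  have := ler_norm z; lra.
Qed.

Lemma tail_left_cts x e : 0 < e ->
  exists d, 0 < d /\ forall y, x - d < y -> tail p y < tail p x + e.
Proof.
move=> e0.
have [||n] :=
  @probability_bigcap_lt (fun k => `](x - k.+1%:R^-1)%R, +oo[%classic) e _ _ e0.
- by move=> i; exact: measurable_itv.
- move=> n m nm z /=; rewrite !in_itv/= !andbT; apply: le_lt_trans.
  by rewrite lerD2l lerN2 lef_pV2 ?posrE// ler_nat.
rewrite -itvcyEbigcap => h; exists n.+1%:R^-1; split; first by rewrite invr_gt0.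
move=> y xy; apply: le_lt_trans h; apply: fine_probability_le => //.
by move=> z /=; rewrite !in_itv/= !andbT; apply: lt_le_trans.
Qed.

Lemma open_tail_near x e : 0 < e ->
  exists d, 0 < d /\ fine (p `]x, +oo[%classic) - e < tail p (x + d).
Proof.
move=> e0.
have : p `[(x + n.+1%:R^-1)%R, +oo[%classic @[n --> \oo] --> (fine (p `]x, +oo[%classic))%:E.
  rewrite fineK ?fin_num_measure// itvoyEbigcup.
  apply: (@nondecreasing_cvg_mu _ _ _ p (fun n => `[(x + n.+1%:R^-1)%R, +oo[%classic)).
  - by move=> i; exact: measurable_itv.
  - by rewrite -itvoyEbigcup; exact: measurable_itv.
  - move=> n m nm; apply/subsetPset => z /=; rewrite !in_itv/= !andbT; apply: le_trans.
    by rewrite lerD2l lef_pV2 ?posrE// ler_nat.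
move=> /fine_cvg /cvgr_gt /(_ (fine (p `]x, +oo[%classic) - e)).
rewrite ltrBlDr ltrDl => /(_ e0) [N _ H]; exists N.+1%:R^-1; split; first by rewrite invr_gt0.
exact: (H N (leqnn N)).
Qed.

Lemma probability_itv_co x y : x <= y -> p `[x, y[%classic = (tail p x - tail p y)%:E.
Proof.
move=> xy; have -> : `[x, y[%classic = `[x, +oo[%classic `\` `[y, +oo[%classic.
  apply/seteqP; split => z /=; rewrite !in_itv/= ?andbT.
    by move=> /andP[-> zy]; split => //; apply/negP; rewrite -ltNge.
  by move=> [-> /negP]; rewrite -ltNge.
rewrite measureD//; last by rewrite ltey_eq fin_num_measure.
rewrite setIidr ?EFinB -?tailE// => z /=; rewrite !in_itv/= !andbT; exact: le_trans.
Qed.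

Lemma tail0_eq1 : p `[0, +oo[%classic = 1%E -> tail p 0 = 1.
Proof. by rewrite /tail => ->. Qed.

(** The drop of the tail from [a] to [b] is the mass of [[a, b[]. If it vanished, the complement of
    []a, b[] would be a closed set of full measure missing [x]; conversely, a closed set of full
    measure missing [x] leaves a null interval around [x]. *)
Lemma suppP x : supp p x <-> forall a b, a < x -> x < b -> tail p b < tail p a.
Proof.
split.
  move=> sx a b ax xb; rewrite lt_neqAle tail_ni ?andbT; last lra.
  apply/eqP => e.
  have mab : measurable `[a, b[%classic by exact: measurable_itv.
  have z : p `[a, b[%classic = 0%E by rewrite probability_itv_co ?e ?subrr//; lra.
  have : p (~` `]a, b[%classic) = 1%E.
    rewrite probability_setC// (_ : p `]a, b[%classic = 0%E) ?sube0//.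
    apply/eqP; rewrite eq_le measure_ge0 andbT -z le_measure ?inE//.
    by move=> t /=; rewrite !in_itv/= => /andP[/ltW -> ->].
  move/(sx _ _) => h; apply: h; last by rewrite /= in_itv/= ax xb.
  by apply: open_closedC; exact: itv_open.
move=> H C cC C1; apply: contrapT => nCx.
have oC : open (~` C) by rewrite openC.
have /nbhs_ballP[e /= e0 eC] : nbhs x (~` C) by apply: open_nbhs_nbhs.
have := H (x - e/2) (x + e/2); rewrite ltrBlDr ltrDl divr_gt0// => /(_ isT isT).
have mC : measurable C by exact: closed_measurable.
have z : p (~` C) = 0%E by rewrite probability_setC// C1 subee.
have : p `[x - e/2, x + e/2[%classic = 0%E.
  apply/eqP; rewrite eq_le measure_ge0 andbT -z le_measure ?inE//; first exact: measurableC.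
  move=> t /=; rewrite in_itv/= => /andP[h1 h2]; apply: eC.
  by rewrite /ball/= ltr_norml; apply/andP; split; lra.
rewrite probability_itv_co; last lra.
by move=> -[] ?; lra.
Qed.
End tail_theory.

(** Left continuity makes the supremum of the points of tail 1 a maximum; it turns out to be the
    minimum of the support. *)
Lemma tail_one_max (R : realType) (p : probability R R) : tail p 0 = 1 ->
  exists t, [/\ 0 <= t, tail p t = 1 & forall e, 0 < e -> tail p (t + e) < 1].
Proof.
move=> p0; pose T := [set x | tail p x = 1].
have [M pM] := tail_small p ltr01.
have Tub : ubound T M.
  move=> x Tx; rewrite leNgt; apply/negP => /ltW /(tail_ni p); rewrite Tx; lra.
have Ts : has_sup T by split; [exists 0|exists M].
have sT x : T x -> x <= sup T by move=> Tx; apply: ub_le_sup => //; case: Ts.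
exists (sup T); split; first exact: sT.
- apply/eqP; rewrite eq_le tail_le1/= leNgt; apply/negP => h.
  have [|d [d0 hd]] := @tail_left_cts _ p (sup T) (1 - tail p (sup T)); first lra.
  have [y Ty yd] := sup_adherent d0 Ts.
  by have := hd y yd; rewrite Ty; lra.
- move=> e e0; rewrite lt_neqAle tail_le1 andbT; apply/eqP => /sT; lra.
Qed.

Lemma inf_suppP (R : realType) (p : probability R R) : tail p 0 = 1 ->
  [/\ supp p (inf (supp p)), forall x, supp p x -> inf (supp p) <= x,
    tail p (inf (supp p)) = 1 & forall e, 0 < e -> tail p (inf (supp p) + e) < 1].
Proof.
move=> p0; have [t [t0 pt ht]] := tail_one_max p0.
have st : supp p t.
  apply/suppP => a b at' tb.
  have -> : b = t + (b - t) by lra.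
  have := tail_ni p (ltW at'); have := ht (b - t); rewrite pt; lra.
have lt x : supp p x -> t <= x.
  move=> /suppP sx; rewrite leNgt; apply/negP => xt.
  have := sx (x - 1) t; rewrite pt => h.
  have := tail_le1 p (x - 1); have := h _ xt; lra.
suff -> : inf (supp p) = t by [].
apply/eqP; rewrite eq_le; apply/andP; split.
  by apply: ge_inf => //; exists t.
by apply: lb_le_inf; [exists t|].
Qed.

Lemma supp_tail_expR (R : realType) (p : probability R R) (t0 a : R) : 0 < a ->
  (forall t, 0 <= t -> tail p (t0 + t) = expR (- (a * t))) ->
  (fun x => x - t0) @` supp p = `[0, +oo[%classic.
Proof.
move=> a0 H.
have pt0 : tail p t0 = 1 by have := H 0 (lexx 0); rewrite addr0 mulr0 oppr0 expR0.
apply/seteqP; split => [_ [x sx <-]|y] /=; rewrite in_itv/= andbT.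
  rewrite leNgt; apply/negP => xt.
  move/suppP : sx => /(_ (x - 1) t0); rewrite pt0 => h.
  have := tail_le1 p (x - 1); have : 1 < tail p (x - 1) by apply: h; lra.
  lra.
move=> y0; exists (t0 + y); last by lra.
apply/suppP => u v uy yv.
have -> : v = t0 + (v - t0) by lra.
have [ut|tu] := leP u t0.
  apply: (@lt_le_trans _ _ 1); last by rewrite -pt0 tail_ni.
  rewrite H; last lra.
  rewrite -expR0 ltr_expR oppr_lt0 mulr_gt0//; lra.
have -> : u = t0 + (u - t0) by lra.
by rewrite !H ?ltr_expR ?ltrN2 ?ltr_pM2l//; lra.
Qed.

Lemma supp_tail_geometric (R : realType) (p : probability R R) (t0 c l : R) :
  0 < c -> 0 < l < 1 ->
  (forall n : nat, tail p (t0 + c * n%:R) = l ^+ n) ->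
  (forall (n : nat) x, 0 < x -> x <= c -> tail p (t0 + c * n%:R + x) = l ^+ n.+1) ->
  (fun x => x - t0) @` supp p = range (fun n : nat => c * n%:R).
Proof.
move=> c0 /andP[l0 l1] Hn Hx.
have pt0 : tail p t0 = 1 by have := Hn 0%N; rewrite mulr0 addr0.
apply/seteqP; split => [_ [x sx <-]|_ [n _ <-]] /=.
  have tx : t0 <= x.
    rewrite leNgt; apply/negP => xt.
    move/suppP : sx => /(_ (x - 1) t0); rewrite pt0 => h.
    have := tail_le1 p (x - 1); have : 1 < tail p (x - 1) by apply: h; lra.
    lra.
  have q0 : 0 <= (x - t0) / c by apply: divr_ge0; lra.
  have /andP[] := truncn_itv q0; set n := Num.truncn _.
  rewrite ler_pdivlMr// ltr_pdivrMr// [_ * c]mulrC [_ * c]mulrC -natr1 mulrDr mulr1 => nx xn.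
  exists n => //; apply/eqP; rewrite eq_le nx/= leNgt; apply/negP => nx'.
  (* Strictly inside a cell there is room on both sides of [x] where the tail is constant, so [x]
     would not be in the support. *)
  pose d := (x - t0 - c * n%:R) / 2.
  have dp : 0 < d by rewrite /d; lra.
  move/suppP : sx => /(_ (t0 + c * n%:R + d) (t0 + c * n%:R + c)).
  rewrite !Hx//; last by rewrite /d; lra.
  by rewrite ltxx => h; apply: notF; apply: h; rewrite /d; lra.
exists (t0 + c * n%:R); last by lra.
apply/suppP => u v uy yv.
apply: (@lt_le_trans _ _ (l ^+ n)); last by rewrite -Hn tail_ni// ltW.
(* A point of the cell just right of the lattice point and not beyond [v]: the tail has already
   dropped to [l ^+ n.+1] there. *)
pose d := Num.min c (v - (t0 + c * n%:R)).
have d0 : 0 < d by rewrite lt_min c0/=; lra.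
apply: (@le_lt_trans _ _ (l ^+ n.+1)).
  rewrite -(Hx n d)// ?ge_min ?lexx// tail_ni//.
  have : d <= v - (t0 + c * n%:R) by rewrite ge_min lexx orbT.
  lra.
by rewrite exprS gtr_pMl// exprn_gt0.
Qed.

(** * Mutual exclusion of the three shapes of support *)

Lemma ray_neq0 (R : realType) : `[0, +oo[%classic <> [set 0] :> set R.
Proof.
move=> e; have : (`[0, +oo[%classic : set R) 1 by rewrite /= in_itv/= andbT.
by rewrite e /= => /eqP; rewrite oner_eq0.
Qed.

Lemma range_mulrn_neq0 (R : realType) (c : R) : 0 < c ->
  range (fun n : nat => c * n%:R) <> [set 0].
Proof.
move=> c0 e; have : range (fun n : nat => c * n%:R) c by exists 1%N => //; rewrite mulr1.
by rewrite e /= => c00; rewrite c00 ltxx in c0.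
Qed.

Lemma ray_neq_range_mulrn (R : realType) (c : R) : 0 < c ->
  `[0, +oo[%classic <> range (fun n : nat => c * n%:R).
Proof.
move=> c0 e; have : (`[0, +oo[%classic : set R) (c / 2) by rewrite /= in_itv/= andbT divr_ge0 ?ltW.
rewrite e => -[n _ /(mulfI (lt0r_neq0 c0)) n2].
have : (n * 2)%:R = 1%:R :> R by rewrite natrM n2 mulVf.
by move=> /eqP; rewrite eqr_nat; case: n {n2} => [|n].
Qed.

(** * Consequences of invariance *)

Section slices.
Variables (R : realType) (p q m : probability R R).

(* For independent X and Y of laws p and q: conditionally on X >= Y + b, the
   law of Y is m. *)
Definition slice_identity := forall (A : set R) (b : R), measurable A -> 0 <= b ->
  (\int[q]_(s in A) (tail p (s + b))%:E = m A * \int[q]_s (tail p (s + b))%:E)%E.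

Lemma measurable_tail b : measurable_fun [set: R] (fun s : R => tail p (s + b)).
Proof.
apply: nonincreasing_measurable => // x y xy; apply: tail_ni; lra.
Qed.

Lemma integrable_tail b : q.-integrable setT (fun s : R => (tail p (s + b))%:E).
Proof.
apply: measurable_bounded_integrable => //.
- by rewrite ltey_eq fin_num_measure.
- exact: measurable_tail.
- exists 1; split => // M M1 x _ /=.
  by rewrite ger0_norm ?tail_ge0// (le_trans (tail_le1 _ _))// ltW.
Qed.

Lemma integral_tail_fin b : (\int[q]_s (tail p (s + b))%:E)%E \is a fin_num.
Proof. by apply: integrable_fin_num => //; exact: integrable_tail. Qed.

Lemma integral_tail0 : (\int[q]_s (tail p s)%:E = \int[q]_s (tail p (s + 0))%:E)%E.
Proof. by apply: eq_integral => s _; rewrite addr0. Qed.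

Hypothesis slice : slice_identity.

Lemma slice0 (A : set R) : measurable A ->
  (\int[q]_(s in A) (tail p s)%:E = m A * \int[q]_s (tail p s)%:E)%E.
Proof.
move=> mA; rewrite integral_tail0 -slice//.
by apply: eq_integral => s _; rewrite addr0.
Qed.

Hypothesis int_neq0 : (\int[q]_s (tail p s)%:E != 0)%E.

Lemma slice_null (A : set R) : measurable A ->
  (\int[q]_(s in A) (tail p s)%:E = 0)%E -> m A = 0%E.
Proof. by move=> mA; rewrite slice0// => /eqP; rewrite mule_eq0 (negbTE int_neq0) orbF => /eqP. Qed.

(** Up to a nonzero constant, [m] has density [tail p] with respect to [q], hence is absolutely
    continuous. *)
Lemma slice_negligible (A : set R) : q.-negligible A -> m.-negligible A.
Proof.
move=> [B [mB qB AB]]; exists B; split => //.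
apply: slice_null => //.
have := @integral_abs_eq0 _ _ _ q B (fun s => (tail p s)%:E) mB _ qB.
rewrite (eq_integral (fun s => (tail p s)%:E)) => [-> //|s _].
  apply: measurable_funTS; apply/measurable_EFinP.
  by have := measurable_tail 0; under eq_fun do rewrite addr0.
by rewrite gee0_abs// lee_fin tail_ge0.
Qed.

Lemma tail_gt0_ae : {ae m, forall s, 0 < tail p s}.
Proof.
have mt := measurable_tail 0.
rewrite (_ : (fun s : R => _) = tail p) in mt; last by apply/funext => s; rewrite addr0.
exists [set s | tail p s = 0]; split.
- by have := mt measurableT [set 0] (measurable_set1 0); rewrite setTI.
- apply: slice_null.
    by have := mt measurableT [set 0] (measurable_set1 0); rewrite setTI.
  by apply: integral0_eq => s /= ->.
- by move=> s /= /negP; rewrite -leNgt => h; apply/eqP; rewrite eq_le h tail_ge0.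
Qed.

(** Over any measurable [E], both sides integrate against [q] to [m E] times the two constants, so
    they agree [q]-almost everywhere, and then [m]-almost everywhere by absolute continuity. *)
Lemma tail_shift_ae b : 0 <= b -> {ae m, forall s,
  fine (\int[q]_s (tail p (s + b))%:E)%E * tail p s =
  fine (\int[q]_s (tail p s)%:E)%E * tail p (s + b)}.
Proof.
move=> b0; set c := fine _; set c0 := fine _.
have ce : (\int[q]_s (tail p (s + b))%:E)%E = c%:E by rewrite fineK// integral_tail_fin.
have c0e : (\int[q]_s (tail p s)%:E)%E = c0%:E.
  by rewrite fineK// integral_tail0 integral_tail_fin.
have i0 : q.-integrable setT (fun s : R => (tail p s)%:E).
  by have := integrable_tail 0; under eq_fun do rewrite addr0.
have ib := integrable_tail b.
have : ae_eq q setT (fun s => c%:E * (tail p s)%:E)%E (fun s => c0%:E * (tail p (s + b))%:E)%E.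
  apply: integral_ae_eq => //.
  - exact: integrableZl.
  - by apply: measurable_int; exact: (integrableZl _ c0 ib).
  - move=> E _ mE.
    rewrite !integralZl//; try by [apply: integrableS ib|apply: integrableS i0].
    by rewrite slice// slice0// ce c0e muleCA (muleC c%:E) [RHS]muleCA.
move=> h; apply: slice_negligible; apply: negligibleS h => s /= + e; apply.
by have [] := e I.
Qed.

(* The exceptional set of [tail_shift_ae] depends on [b]: it is avoided
   simultaneously for all rational [b], and left continuity does the rest. *)
Lemma tail_proportional_ae : exists S : set R, [/\ m.-negligible (~` S),
  forall s, S s -> 0 < tail p s &
  forall s s' b, S s -> S s' -> 0 <= b ->
    tail p (s + b) * tail p s' = tail p (s' + b) * tail p s].
Proof.
(* An enumeration of the nonnegative rationals; integers that code no rational give 0. *)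
pose r n : R := `|ratr (odflt 0 (unpickle n))|.
pose c b := fine (\int[q]_s (tail p (s + b))%:E)%E.
pose c0 := fine (\int[q]_s (tail p s)%:E)%E.
pose S := [set s | 0 < tail p s /\ forall n, c (r n) * tail p s = c0 * tail p (s + r n)].
have c00 : c0 != 0.
  apply: contra int_neq0 => /eqP e; rewrite -(@fineK _ (\int[q]_s _)%E) -/c0 ?e//.
  by rewrite integral_tail0 integral_tail_fin.
exists S; split.
- apply: (@negligibleS _ _ _ _ (~` [set s | 0 < tail p s] `|`
     \bigcup_n ~` [set s | c (r n) * tail p s = c0 * tail p (s + r n)])).
    move=> s /= /not_andP[h|/existsNP[n h]]; [by left|right; by exists n].
  apply: negligibleU; first exact: tail_gt0_ae.
  by apply: negligible_bigcup => n; apply: tail_shift_ae; rewrite /r.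
- by move=> s [].
- have rat_eq s s' n : S s -> S s' ->
      tail p (s + r n) * tail p s' = tail p (s' + r n) * tail p s.
    move=> [_ hs] [_ hs']; apply: (mulfI c00).
    by rewrite !mulrA -hs -hs'; ring.
  (* By symmetry in s and s', one inequality is enough. *)
  have half s s' b : S s -> S s' -> 0 <= b ->
      tail p (s + b) * tail p s' <= tail p (s' + b) * tail p s.
    move=> Ss Ss' b0; apply/ler_addgt0Pr => e e0.
    have [d [d0 hd]] := @tail_left_cts _ p (s' + b) e e0.
    have [n rb br] : exists2 n, r n <= b & b - d < r n.
      (* No nonnegative rational lies strictly below [b = 0], so there 0 itself is taken. *)
      move: b0; rewrite le_eqVlt => /predU1P[<-|b0].
        exists (pickle (0 : rat)); rewrite /r pickleK /= rmorph0 normr0//; lra.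
      have [|x] := @rat_in_itvoo R (Num.max (b - d) 0) b.
        by rewrite gt_max b0 andbT; lra.
      rewrite in_itv/= gt_max => /andP[/andP[bx x0] xb].
      by exists (pickle x); rewrite /r pickleK /= gtr0_norm// ltW.
    have h1 : tail p (s + b) * tail p s' <= tail p (s + r n) * tail p s'.
      by rewrite ler_wpM2r ?tail_ge0// tail_ni// lerD2l.
    apply: (le_trans h1); rewrite rat_eq//.
    have h2 : tail p (s' + r n) <= tail p (s' + b) + e by rewrite ltW// hd//; lra.
    apply: (@le_trans _ _ ((tail p (s' + b) + e) * tail p s)).
      by rewrite ler_wpM2r ?tail_ge0.
    by rewrite mulrDl lerD2l ler_piMr ?tail_le1// ltW.
  move=> s s' b Ss Ss' b0; apply/eqP; rewrite eq_le !half//.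
Qed.
End slices.

(** A function bounded by 1 with integral 1 against the probability [q] equals 1 [q]-almost
    everywhere; absolute continuity transfers this to [m]. *)
Lemma tail_eq1_ae (R : realType) (p q m : probability R R) :
  slice_identity p q m -> (\int[q]_s (tail p s)%:E = 1)%E ->
  {ae m, forall s, tail p s = 1}.
Proof.
move=> slice i1.
have mt := measurable_tail p 0.
rewrite (_ : (fun s : R => _) = tail p) in mt; last by apply/funext => s; rewrite addr0.
have i0 : q.-integrable setT (fun s : R => (tail p s)%:E).
  by have := integrable_tail p q 0; under eq_fun do rewrite addr0.
apply: (slice_negligible slice); first by rewrite i1 oner_neq0.
have iB : (\int[q]_s `|1 - (tail p s)%:E| = 0)%E.
  under eq_integral => s _.
    rewrite gee0_abs; last by rewrite sube_ge0 ?lee_fin ?tail_le1.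
    over.
  rewrite integralB//; last exact: finite_measure_integrable_cst.
  rewrite i1 (_ : integral _ _ _ = 1%E) ?subee//.
  by rewrite integral_cst// mul1e; exact: probability_setT.
have mB : measurable_fun [set: R] (fun s : R => 1 - (tail p s)%:E)%E.
  by apply: emeasurable_funB => //; apply/measurable_EFinP.
have [/(_ iB) h _] := ae_eq_integral_abs q measurableT mB.
apply: negligibleS h => s /= + e; apply; move: (e I).
by rewrite -EFinB => /eqP; rewrite eqe subr_eq0 => /eqP <-.
Qed.

(** * Half-planes under a product measure *)

Section product_halfplanes.
Variables (R : realType) (p q : probability R R).

Lemma measurable_lower_half (A : set R) (b : R) : measurable A ->
  measurable [set x : R * R | A x.2 /\ x.2 + b <= x.1].
Proof.
move=> mA; rewrite (_ : mkset _ = snd @^-1` A `&` (fun x => x.1 - x.2) @^-1` `[b, +oo[%classic).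
  apply: measurableI; first by rewrite -[X in measurable X]setTI; exact: measurable_snd.
  rewrite -[X in measurable X]setTI.
  by apply: measurable_funB => //; exact: measurable_itv.
by apply/seteqP; split => x /=; rewrite in_itv/= andbT => -[? ?]; split => //; lra.
Qed.

Lemma measurable_upper_half (A : set R) (b : R) : measurable A ->
  measurable [set x : R * R | A x.1 /\ x.1 + b <= x.2].
Proof.
move=> mA; rewrite (_ : mkset _ = fst @^-1` A `&` (fun x => x.2 - x.1) @^-1` `[b, +oo[%classic).
  apply: measurableI; first by rewrite -[X in measurable X]setTI; exact: measurable_fst.
  rewrite -[X in measurable X]setTI.
  by apply: measurable_funB => //; exact: measurable_itv.
by apply/seteqP; split => x /=; rewrite in_itv/= andbT => -[? ?]; split => //; lra.
Qed.

Lemma product_upper_half (A : set R) (b : R) : measurable A ->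
  ((p \x q) [set x : R * R | A x.1 /\ (x.1 + b <= x.2)%R] = \int[p]_(r in A) (tail q (r + b))%:E)%E.
Proof.
move=> mA; rewrite /product_measure1 [RHS]integral_mkcond.
apply: eq_integral => r _ /=; rewrite patchE.
case: ifPn => [|]; rewrite ?inE ?notin_setE => Ar.
  rewrite -tailE; congr (q _); apply/seteqP; split => s.
    by rewrite /xsection/= inE/= in_itv/= andbT => -[].
  by rewrite /xsection/= inE/= in_itv/= andbT.
rewrite (_ : xsection _ _ = set0) ?measure0//.
by rewrite -subset0 => s; rewrite /xsection/= inE/= => -[].
Qed.

(** The sections are now taken at a fixed second coordinate; uniqueness of the product measure
    allows integrating in that order. *)
Lemma product_lower_half (A : set R) (b : R) : measurable A ->
  ((p \x q) [set x : R * R | A x.2 /\ (x.2 + b <= x.1)%R] = \int[q]_(s in A) (tail p (s + b))%:E)%E.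
Proof.
move=> mA.
rewrite (@product_measure_unique _ _ _ _ _ p q (p \x^ q)%E); first last.
- exact: measurable_lower_half.
- by move=> B C mB mC; rewrite /= product_measure2E.
rewrite /= /product_measure2 [RHS]integral_mkcond.
apply: eq_integral => r _ /=; rewrite patchE.
case: ifPn => [|]; rewrite ?inE ?notin_setE => Ar.
  rewrite -tailE; congr (p _); apply/seteqP; split => s.
    by rewrite /ysection/= inE/= in_itv/= andbT => -[].
  by rewrite /ysection/= inE/= in_itv/= andbT.
rewrite (_ : ysection _ _ = set0) ?measure0//.
by rewrite -subset0 => s; rewrite /ysection/= inE/= => -[].
Qed.
End product_halfplanes.

(** * Identities between the three laws *)

Section invariance.
Variables (R : realType) (p1 p2 p3 : probability R R).
Hypothesis inv : forall A : set ((R * R) * R), measurable A ->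
  ((p1 \x p2) \x p3)%E ((@Rmap R) @^-1` A) = ((p1 \x p2) \x p3)%E A.

(** Invariance is exploited through rectangles whose preimage leaves [t] free, so that the factor
    [p3] disappears on one side. *)
Lemma invariant_rectangle (D D' : set (R * R)) (A : set R) :
  measurable D -> measurable D' -> measurable A ->
  (@Rmap R) @^-1` (D `*` A) = D' `*` setT ->
  ((p1 \x p2) D' = (p1 \x p2) D * p3 A)%E.
Proof.
move=> mD mD' mA e; have := inv (measurableX mD mA).
rewrite e !product_measure1E// => <-.
by rewrite -[LHS]mule1; congr (_ * _)%E; rewrite -[LHS](probability_setT p3).
Qed.

Lemma invariant_tail a : tail p3 a = tail p1 a * tail p2 a.
Proof.
have mi : measurable (`[a, +oo[%classic : set R) by exact: measurable_itv.
have := @invariant_rectangle setT (`[a, +oo[%classic `*` `[a, +oo[%classic) `[a, +oo[%classic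
  measurableT (measurableX mi mi) mi.
have -> : (p1 \x p2)%E setT = 1%E by rewrite -(probability_setT (p1 \x p2)%E).
rewrite product_measure1E// mul1e => h.
apply: EFin_inj; rewrite EFinM -!tailE; apply/esym/h.
apply/seteqP; split => -[[r s] t] /=; rewrite !in_itv/= !andbT le_min.
  by move=> [_ /andP[]].
by move=> [[-> ->]].
Qed.

(** [Rmap] preserves the difference of the first two coordinates, and its third output is [s] when
    [r >= s]. Hence the outputs with difference at least [b] and third coordinate in [A] come
    exactly from [s] in [A] and [r >= s + b]. *)
Lemma invariant_slice_lower : slice_identity p1 p2 p3.
Proof.
move=> A b mA b0; rewrite -product_lower_half// muleC.
have e : (\int[p2]_s (tail p1 (s + b))%:E =
    (p1 \x p2) [set x : R * R | setT x.2 /\ (x.2 + b <= x.1)%R])%E by rewrite product_lower_half.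
rewrite e; apply: invariant_rectangle => //; try exact: measurable_lower_half.
apply/seteqP; split => -[[r s] t] /=.
  (* When the minimum evaluates to [r], [b >= 0] forces [r = s]. *)
  by case: (leP r s); case: (leP (r - s) 0); case: (leP (s - r) 0) => h1 h2 h3 [[_ h4] Am];
    split => //; split => //; try lra; have <- : r = s by lra.
by case: (leP r s); case: (leP (r - s) 0); case: (leP (s - r) 0) => h1 h2 h3 [[Am h4] _];
    split => //; try (split => //; lra); have -> : r = s by lra.
Qed.

Lemma invariant_slice_upper : slice_identity p2 p1 p3.
Proof.
move=> A b mA b0; rewrite -product_upper_half// muleC.
have e : (\int[p1]_s (tail p2 (s + b))%:E =
    (p1 \x p2) [set x : R * R | setT x.1 /\ (x.1 + b <= x.2)%R])%E by rewrite product_upper_half.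
rewrite e; apply: invariant_rectangle => //; try exact: measurable_upper_half.
apply/seteqP; split => -[[r s] t] /=.
  by case: (leP r s); case: (leP (r - s) 0); case: (leP (s - r) 0) => h1 h2 h3 [[_ h4] Am];
    split => //; split => //; lra.
by case: (leP r s); case: (leP (r - s) 0); case: (leP (s - r) 0) => h1 h2 h3 [[Am h4] _];
    split => //; try (split => //; lra); lra.
Qed.
End invariance.

(** The integrals are the masses of the half-planes [s <= r] and [r <= s], which cover the plane. *)
Lemma integral_tails_ge1 (R : realType) (p q : probability R R) :
  (1 <= \int[q]_s (tail p s)%:E + \int[p]_s (tail q s)%:E)%E.
Proof.
rewrite !integral_tail0 -product_lower_half// -product_upper_half//.
set L := mkset _; set U := mkset _.
have mL : measurable L by exact: measurable_lower_half.
have mU : measurable U by exact: measurable_upper_half.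
have <- : (p \x q)%E (L `|` U) = 1%E.
  rewrite (_ : L `|` U = setT) ?probability_setT//; apply/seteqP; split => // -[r s] _.
  rewrite /L /U /=; case: (leP s r) => [sr|/ltW rs]; [left|right]; split => //; lra.
exact: measureU2.
Qed.

Lemma negligible_meet (R : realType) (m : probability R R) (S : set R) x y :
  m.-negligible (~` S) -> x <= y -> tail m y < tail m x ->
  exists s, [/\ S s, x <= s & s < y].
Proof.
move=> nS xy; apply: contraPP => /forallNP noS.
have n : m.-negligible `[x, y[%classic.
  apply: negligibleS nS => s /=; rewrite in_itv/= => /andP[xs sy] Ss.
  exact: (noS s).
have : (tail m x - tail m y)%:E = 0%E.
  by rewrite -probability_itv_co//; exact: measure_negligible.
by move=> [e]; apply/negP; rewrite -leNgt; lra.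
Qed.

(* If the integral vanished, [tail q] would equal 1 almost everywhere for [m],
   although it decreases strictly between points of a full set. *)
Lemma integral_tail_neq0 (R : realType) (p q m : probability R R) x y z :
  slice_identity q p m -> x <= y -> y <= z -> tail m y < tail m x -> tail m z < tail m y ->
  (\int[q]_s (tail p s)%:E != 0)%E.
Proof.
move=> slice xy yz mxy myz; apply/eqP => i0.
have i1 : (\int[p]_s (tail q s)%:E = 1)%E.
  apply/eqP; rewrite eq_le; apply/andP; split; last first.
    by have := integral_tails_ge1 p q; rewrite i0 add0e.
  apply: (@le_trans _ _ (\int[p]_s 1)%E).
    apply: ge0_le_integral => //.
    - by move=> s _; rewrite lee_fin tail_ge0.
    - by apply/measurable_EFinP; have := measurable_tail q 0; under eq_fun do rewrite addr0.
    - by move=> s _; rewrite lee_fin tail_le1.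
  rewrite integral_cst// mul1e; exact: probability_le1.
have i1n : (\int[p]_s (tail q s)%:E != 0)%E by rewrite i1 oner_neq0.
have [S [nS Spos Sprop]] := tail_proportional_ae slice i1n.
have nT : m.-negligible (~` (S `&` [set s | tail q s = 1])).
  by rewrite setCI; apply: negligibleU => //; exact: tail_eq1_ae slice i1.
(* Two disjoint intervals of positive mass supply two distinct points of the full set. *)
have [s0 [[S0 e0] _ s0y]] := negligible_meet nT xy mxy.
have [s1 [[S1 e1] ys1 _]] := negligible_meet nT yz myz.
have := ratio_lt1 (@tail_ni _ q) (@tail_small _ q) Spos Sprop S0 S1 (lt_le_trans s0y ys1).
by rewrite e0 e1 ltxx.
Qed.

Lemma supp_shift_eq0 (R : realType) (p : probability R R) : tail p 0 = 1 ->
  (forall a, 0 < a -> tail p (inf (supp p) + a) = 0) ->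
  (fun x => x - inf (supp p)) @` supp p = [set 0].
Proof.
move=> p0 H; have [st lt _ _] := inf_suppP p0.
set t := inf _ in H st lt *.
apply/seteqP; split => [_ [x sx <-]|_ ->] /=; last by exists t; rewrite ?subrr.
apply/eqP; rewrite subr_eq0 eq_le lt// andbT leNgt; apply/negP => tx.
(* Both endpoints lie beyond [t], where the tail vanishes, so there is no drop around [x]. *)
move/suppP : sx => /(_ ((t + x) / 2) (x + 1)).
have -> : (t + x) / 2 = t + ((x - t) / 2) by lra.
have -> : x + 1 = t + (x + 1 - t) by lra.
by rewrite !H ?ltxx; try lra; move=> h; apply: notF; apply: h; lra.
Qed.

(* Either t is an atom, and then lies in S, or [tail m] is right-continuous at t. *)
Lemma negligible_near (R : realType) (m : probability R R) (S : set R) t e :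
  m.-negligible (~` S) -> tail m t = 1 -> (forall d, 0 < d -> tail m (t + d) < 1) -> 0 < e ->
  exists s, [/\ S s, t <= s, s < t + e & 1 - e < tail m s].
Proof.
move=> nS mt mlt e0; have [St|nSt] := pselect (S t).
  by exists t; split => //; rewrite ?mt; lra.
have m0 : m [set t] = 0%E.
  by apply: measure_negligible => //; apply: negligibleS nS => _ ->.
have mo : fine (m `]t, +oo[%classic) = 1.
  rewrite (_ : `]t, +oo[%classic = `[t, +oo[%classic `\` [set t]).
    rewrite measureD//; last by rewrite ltey_eq fin_num_measure.
    rewrite setIidr; last by move=> _ ->; rewrite /= in_itv/= lexx.
    by rewrite [X in (_ - X)%E]m0 sube0.
  apply/seteqP; split => x /=; rewrite !in_itv/= !andbT.
    by move=> tx; split; [exact: ltW|move=> xt; rewrite xt ltxx in tx].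
  by move=> [tx /eqP xt]; rewrite lt_neqAle eq_sym xt.
have [d [d0]] := open_tail_near m t e0; rewrite mo => hd.
pose d' := Num.min d e.
have d'0 : 0 < d' by rewrite lt_min d0.
have [||s [Ss ts sd]] := @negligible_meet _ _ _ t (t + d') nS; [lra|by rewrite mt mlt|].
have d'd : d' <= d by rewrite ge_min lexx.
have d'e : d' <= e by rewrite ge_min lexx orbT.
exists s; split => //; first lra.
apply: lt_le_trans hd _; apply: tail_ni; lra.
Qed.

(** * Assembly of the trichotomy *)

Theorem mainTheorem1 (R : realType) (pi1 pi2 pi3 : probability R R) :
  pi1 `[0, +oo[%classic = 1%E -> pi2 `[0, +oo[%classic = 1%E -> pi3 `[0, +oo[%classic = 1%E ->
  (forall A : set ((R * R) * R), measurable A ->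
     ((pi1 \x pi2) \x pi3)%E ((@Rmap R) @^-1` A) = ((pi1 \x pi2) \x pi3)%E A) ->
  let t0 := inf (supp pi3) in
  let U1 := (fun x => x - t0) @` supp pi1 in
  let U2 := (fun x => x - t0) @` supp pi2 in
  let U3 := (fun x => x - t0) @` supp pi3 in
  let F1 := fun t => pi1 `[t0 + t, +oo[%classic in
  let F2 := fun t => pi2 `[t0 + t, +oo[%classic in
  let F3 := fun t => pi3 `[t0 + t, +oo[%classic in
  exactly_one3
    (U3 = [set 0])
    ([/\ U1 = `[0, +oo[%classic, U2 = `[0, +oo[%classic & U3 = `[0, +oo[%classic] /\
     exists a1 a2 : R, [/\ 0 < a1, 0 < a2 &
       forall t : R, 0 <= t ->
         [/\ F1 t = (expR (- (a1 * t)))%:E, F2 t = (expR (- (a2 * t)))%:E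
           & F3 t = (expR (- ((a1 + a2) * t)))%:E]])
    (exists c : R, 0 < c /\
      [/\ U1 = range (fun n : nat => c * n%:R), U2 = range (fun n : nat => c * n%:R)
        & U3 = range (fun n : nat => c * n%:R)] /\
      exists l1 l2 : R, [/\ 0 < l1 < 1, 0 < l2 < 1 &
        forall n : nat,
          [/\ F1 (c * n%:R) = (l1 ^+ n)%:E, F2 (c * n%:R) = (l2 ^+ n)%:E
            & F3 (c * n%:R) = ((l1 * l2) ^+ n)%:E]]).
Proof.
move=> _ _ /tail0_eq1 p30 inv t0 U1 U2 U3 F1 F2 F3.
have [U30|U30] := pselect (U3 = [set 0]).
  constructor 1; split => //.
    by move=> [[_ _ e] _]; apply: (@ray_neq0 R); rewrite -e.
  by move=> [c [c0 [[_ _ e] _]]]; apply: (range_mulrn_neq0 c0); rewrite -e.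
have [_ _ t31 t3lt] := inf_suppP p30; rewrite -/t0 in t31 t3lt.
(* As [pi3] is not a point mass, there are [t0 < t0 + a <= z] between which its tail drops twice, as
   [integral_tail_neq0] requires. *)
have [a [a0 ta]] : exists a, 0 < a /\ 0 < tail pi3 (t0 + a).
  apply: contrapT => /forallNP h; apply: U30; apply: supp_shift_eq0 => // a a0.
  apply/eqP; rewrite eq_le tail_ge0 andbT leNgt; apply/negP => ha; exact: (h a).
have [z tz] := tail_small pi3 ta; rewrite -/t0 in tz.
have az : t0 + a <= z by rewrite leNgt; apply/negP => /ltW /(tail_ni pi3); lra.
have tat : tail pi3 (t0 + a) < tail pi3 t0 by rewrite t31; exact: t3lt.
have t0a : t0 <= t0 + a by lra.
have tE x : tail pi3 x = tail pi1 x * tail pi2 x := invariant_tail inv x.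
have sl := invariant_slice_lower inv; have su := invariant_slice_upper inv.
(* The integral belonging to one slice identity is nonzero by the opposite identity. *)
have [S1 [nS1 S1p S1e]] := tail_proportional_ae sl (integral_tail_neq0 su t0a az tat tz).
have [S2 [nS2 S2p S2e]] := tail_proportional_ae su (integral_tail_neq0 sl t0a az tat tz).
have t11 : tail pi1 t0 = 1.
  apply/eqP; rewrite eq_le tail_le1 -t31 tE ler_piMr ?tail_ge0 ?tail_le1//.
have t21 : tail pi2 t0 = 1.
  apply/eqP; rewrite eq_le tail_le1 -t31 tE ler_piMl ?tail_ge0 ?tail_le1//.
(* One set serves both laws; the cut at [t0] keeps it full because [tail pi3 t0 = 1]. *)
pose S := (S1 `&` S2) `&` `[t0, +oo[%classic.
have nS : pi3.-negligible (~` S).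
  rewrite !setCI; apply: negligibleU; first exact: negligibleU.
  have mt : measurable (`[t0, +oo[%classic : set R) by exact: measurable_itv.
  apply/negligibleP; first exact: measurableC.
  by have := probability_setC pi3 mt; rewrite tailE t31 subee.
have [] := @tail_dichotomy R (tail pi1) (tail pi2) S t0 (@tail_ni _ pi1) (@tail_ni _ pi2)
  (@tail_small _ pi1) (@tail_small _ pi2).
- by move=> s [[/S1p]].
- by move=> s [[_ /S2p]].
- by move=> s s' b [[h _] _] [[h' _] _]; exact: S1e.
- by move=> s s' b [[_ h] _] [[_ h'] _]; exact: S2e.
- by move=> s [_] /=; rewrite in_itv/= andbT.
- exact: t11.
- exact: t21.
- move=> e e0; have [s [Ss _ se ms]] := negligible_near nS t31 t3lt e0.
  by exists s; split => //; rewrite -tE.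
- by have [s [Ss ss _]] := negligible_meet nS az tz; exists s; split => //; lra.
(* A drop of [tail pi3] from [x] to [y] would give [[x, y[] positive mass and hence a point of
   [S]. *)
- move=> x y xy noS; rewrite -!tE; apply/eqP; rewrite eq_le (tail_ni pi3 xy) andbT leNgt.
  by apply/negP => /(negligible_meet nS xy)[s [Ss xs sy]]; exact: (noS s).
- move=> [a1 [a2 [a10 a20 ht]]].
  have ht3 t : 0 <= t -> tail pi3 (t0 + t) = expR (- ((a1 + a2) * t)).
    by move=> tp; have [h1 h2] := ht t tp; rewrite tE h1 h2 -expRD; congr expR; ring.
  have e3 : U3 = `[0, +oo[%classic.
    by apply: (supp_tail_expR (a := a1 + a2)) => //; rewrite addr_gt0.
  constructor 2; split => //.
    split; first split => //.
    + by apply: (supp_tail_expR a10) => t /ht[].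
    + by apply: (supp_tail_expR a20) => t /ht[].
    exists a1, a2; split => // t tp; have [h1 h2] := ht t tp.
    by rewrite /F1 /F2 /F3 !tailE h1 h2 ht3.
  by move=> [c [c0 [[_ _ e] _]]]; apply: (ray_neq_range_mulrn c0); rewrite -e3 -e.
- move=> [c [l1 [l2 [c0 hl1 hl2 hn hx]]]].
  have hn3 n : tail pi3 (t0 + c * n%:R) = (l1 * l2) ^+ n.
    by have [h1 h2] := hn n; rewrite tE h1 h2 exprMn.
  have hx3 (n : nat) x : 0 < x -> x <= c -> tail pi3 (t0 + c * n%:R + x) = (l1 * l2) ^+ n.+1.
    by move=> x0 xc; have [h1 h2] := hx n x x0 xc; rewrite tE h1 h2 exprMn.
  have hl3 : 0 < l1 * l2 < 1.
    by case/andP: hl1 => ? ?; case/andP: hl2 => ? ?; rewrite mulr_gt0//= mulr_ilt1// ltW.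
  have e3 : U3 = range (fun n : nat => c * n%:R) by exact: (supp_tail_geometric c0 hl3).
  constructor 3; split => //.
    by move=> [[_ _ e] _]; apply: (ray_neq_range_mulrn c0); rewrite -e3 -e.
  exists c; split => //; split; first split => //.
  + apply: (supp_tail_geometric c0 hl1) => n; first by have [] := hn n.
    by move=> x x0 xc; have [] := hx n x x0 xc.
  + apply: (supp_tail_geometric c0 hl2) => n; first by have [] := hn n.
    by move=> x x0 xc; have [] := hx n x x0 xc.
  exists l1, l2; split => // n; have [h1 h2] := hn n.
  by rewrite /F1 /F2 /F3 !tailE h1 h2 hn3.
Qed.
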